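(* Let $C\ge 1$ be an arbitrary constant and let $f:\mathbb{N}\to\mathbb{C}$ be a complex-valued strongly additive function satisfying (1) $|f(p)|\le C$ for each prime $p$; (2) $\sum_{n\le N}|f(n)|\ll N\log\log N$; (3) $\sum_{n\le N}|f(n)|^2\ll N(\log\log N)^2$. Suppose that $\left|\Theta-\frac aq\right|\le\frac1{q^2}$ where $(a,q)=1$, and that $2\le R\le q\le N/R$. Then $$\sum_{n\le N}f(n)e(\Theta n)\ll_{C}\frac{N\log\log N}{\log N}+\frac{N\log\log N\,(\log R)^{\frac32}}{R^{\frac12}}.$$
   Context: $e(x)=\exp(2\pi i x)$ for real $x$; $\Theta$ is real, $a\in\mathbb{Z}$, $q\in\mathbb{N}$. An arithmetic function $f$ on the positive integers is additive if $f(mn)=f(m)+f(n)$ whenever $(m,n)=1$, and strongly additive if moreover $f(p^k)=f(p)$ for all primes $p$ and integers $k\ge1$. $F\ll G$ means $|F|\le c|G|$ for a suitable constant $c$ (for large values of the variable $N$); implied constants depend on $C$ (including those in (2) and (3)) and the conclusion is uniform in $\Theta,a,q,R$. *)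

(* Defs.v *)
From mathcomp Require Import all_boot all_order all_algebra.
From mathcomp Require Import complex.
From mathcomp Require Import all_classical all_reals all_analysis.

Set Implicit Arguments.
Unset Strict Implicit.
Unset Printing Implicit Defensive.

Import Order.TTheory GRing.Theory Num.Theory.

Local Open Scope ring_scope.
Local Open Scope complex_scope.

(* The library norm on [K[i]] takes its values in [K[i]]; [normc] is the
   corresponding element of [K]. *)
Definition cabs (K : realType) (z : K[i]) : K := ComplexField.Normc.normc z.

Definition cexp (K : realType) (z : K[i]) : K[i] :=
  (expR (complex.Re z))%:C *
  (cos (complex.Im z) +i* sin (complex.Im z)).

Definition e (K : realType) (x : K) : K[i] := cexp (2 * (pi : K)%:C * 'i * x%:C).

(* Arithmetic functions live on the positive integers: the value at [0] is
   never constrained and never used. *)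
Definition additive_fun (K : realType) (f : nat -> K[i]) : Prop :=
  forall m n : nat, (0 < m)%N -> (0 < n)%N -> coprime m n ->
    f (m * n)%N = f m + f n.

Definition strongly_additive (K : realType) (f : nat -> K[i]) : Prop :=
  additive_fun f /\
  forall p k : nat, prime p -> (1 <= k)%N -> f (p ^ k)%N = f p.

(* Main.v *)
Require Import Defs.
From mathcomp Require Import all_boot all_order all_algebra.
From mathcomp Require Import complex.
From mathcomp Require Import all_classical all_reals all_analysis.
From mathcomp Require Import unstable zify ring lra.

Set Implicit Arguments.
Unset Strict Implicit.
Unset Printing Implicit Defensive.

Import Order.TTheory GRing.Theory Num.Theory.

Local Open Scope ring_scope.

(** Strong additivity gives f(n) = \sum_(p | n) f(p), so that the sum to bound is
    \sum_p f(p) T(p), where T(p) = \sum_(m <= N / p) e(Theta p m) is a geometric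
    sum. Hence |T(p)| is at most both N / p and 2 / |e(Theta p) - 1|, and
    since |f(p)| <= C it is enough to bound the sum of |T(p)| over the primes
    p <= N. Let D be a power of 2 of size about N / (log N)^2.

    - For p > D the bound N / p is used. By Chebyshev's argument the primes of
      (2^k, 2^(k+1)] contribute O(1 / k) to \sum_p 1 / p
      ([dyadic_prime_sum_le]), and only O(log log N) values of k occur, all of
      size log N; the total is O(N log log N / log N).

    For p <= D the given fraction a / q is replaced by one adapted to D:
    Dirichlet's theorem with denominators up to 2 D yields coprime a1, q1 with
    |q1 Theta - a1| <= 1 / (2 D), hence |Theta p - a1 p / q1| <= 1 / (2 q1).

    - If q1 does not divide p, then Theta p is at least half as far from the
      integers as a1 p / q1. Summing over all integers p <= D instead of primes,
      one runs through full periods of nonzero residues mod q1, each costing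
      O(q1 log N) ([sum_nonmultiples_le]). The total O((D + q1) log N) is
      O(N / log N), no matter how small or large q1 is.

    - If q1 divides the prime p, then p = q1 or q1 = 1. Comparing a1 / q1 with
      a / q shows that either q1 >= q / 2 or |q1 Theta - a1| >= 1 / (2 q)
      ([approximation_dichotomy]); with R <= q <= N / R both cases
      give |T(k q1)| <= 2 N / (R k). Summed over the primes p = k q1 this is
      O((N / R) (1 + \sum_p 1 / p)) = O(N log log N / R), and
      1 / R is O((log R)^(3/2) / R^(1/2)) for R >= 2. *)

(** * Chebyshev and Mertens upper bounds *)

Lemma prime_dvd_fact p n : prime p -> (p %| n`!)%N -> (p <= n)%N.
Proof.
move=> pr_p; rewrite fact_prod; elim: n => [|n IHn].
  by rewrite big_nil Euclid_dvd1.
rewrite big_nat_recr //= Euclid_dvdM // => /orP[/IHn|]; first by lia.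
by move/dvdn_leq; apply.
Qed.

Lemma prime_dvd_central_bin x p :
  prime p -> (x < p <= x.*2)%N -> (p %| 'C(x.*2, x))%N.
Proof.
move=> pr_p /andP[ltxp lep2x].
have p_gt0 := prime_gt0 pr_p.
have : (p %| (x.*2)`!)%N by apply: dvdn_fact; rewrite p_gt0.
rewrite -(@bin_fact x.*2 x) -?addnn ?leq_addl // addnK addnn.
by rewrite !Euclid_dvdM // => /orP[//|/orP[]] /(prime_dvd_fact pr_p); lia.
Qed.

Lemma bin_le_expn2 n m : ('C(n, m) <= 2 ^ n)%N.
Proof.
have [ltnm|lemn] := ltnP n m; first by rewrite bin_small.
rewrite (expnDn 1 1 n) (bigD1 (inord m)) //= inordK // !exp1n !muln1.
exact: leq_addr.
Qed.

(** A prime in (2 ^ k, 2 ^ k.+1] divides the central binomial coefficient of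
    2 ^ k.+1, which is at most 2 ^ (2 ^ k.+1); as each of these primes exceeds
    2 ^ k, there are at most 2 ^ k.+1 / k of them. *)
Lemma dyadic_prime_count k :
  (k * \sum_((2 ^ k).+1 <= p < (2 ^ k.+1).+1 | prime p) 1 <= 2 ^ k.+1)%N.
Proof.
set r := index_iota _ _.
rewrite -(@leq_exp2l 2) // expnM.
have dvd_prod : (\prod_(p <- r | prime p) p %| 'C(2 ^ k.+1, 2 ^ k))%N.
  apply/Gauss_dvd_prod => [|p].
    have: uniq r by apply: iota_uniq.
    rewrite map_id uniq_pairwise => /(pairwise_filter prime).
    apply: sub_in_pairwise (filter_all prime r) => p q pr_p pr_q neq_pq.
    by rewrite prime_coprime // dvdn_prime2.
  rewrite mem_index_iota ltnS expnS mul2n => lep pr_p.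
  exact: prime_dvd_central_bin.
apply: (@leq_trans (\prod_(p <- r | prime p) p)); last first.
  by apply: leq_trans (bin_le_expn2 _ (2 ^ k)); rewrite dvdn_leq // bin_gt0 leq_exp2l.
rewrite expn_sum big_seq_cond [leqRHS]big_seq_cond; apply: leq_prod => p.
by rewrite mem_index_iota expn1 => /andP[/andP[/ltnW]].
Qed.

Section Sums.
Variable K : realFieldType.

(** Each dyadic block 2 ^ k <= s < 2 ^ k.+1 contributes at most 1. *)
Lemma harmonic_sum_le k : \sum_(1 <= s < 2 ^ k) (s%:R)^-1 <= k%:R :> K.
Proof.
elim: k => [|k IHk]; first by rewrite big_geq.
rewrite (@big_cat_nat _ _ _ (2 ^ k)) ?leq_exp2l ?expn_gt0 //= -natr1.
apply: lerD => //.
apply: (@le_trans _ _ (\sum_(2 ^ k <= s < 2 ^ k.+1) ((2 ^ k)%:R : K)^-1)).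
  rewrite big_nat_cond [leRHS]big_nat_cond; apply: ler_sum => s.
  rewrite andbT => /andP[les _].
  by rewrite lef_pV2 ?ler_nat ?posrE ?ltr0n ?(leq_trans _ les) ?expn_gt0.
rewrite sumr_const_nat.
have -> : (2 ^ k.+1 - 2 ^ k = 2 ^ k)%N by rewrite expnS mul2n -addnn addnK.
by rewrite -[leLHS]mulr_natl mulfV // pnatr_eq0 expn_eq0.
Qed.

(** The last term accounts for k = 0, where 0^-1 = 0 and the only prime is 2. *)
Lemma dyadic_prime_sum_le k :
  \sum_((2 ^ k).+1 <= p < (2 ^ k.+1).+1 | prime p) (p%:R)^-1
    <= 2 * (k%:R)^-1 + (k == 0%N)%:R :> K.
Proof.
have [->|k_gt0] := posnP k.
  rewrite invr0 mulr0 add0r big_mkcond /= big_nat1 /=.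
  by rewrite invf_le1 ?ltr0n // ler1n.
rewrite addr0.
pose c := (\sum_((2 ^ k).+1 <= p < (2 ^ k.+1).+1 | prime p) 1)%N.
apply: (@le_trans _ _ (c%:R * ((2 ^ k)%:R : K)^-1)).
  rewrite /c natr_sum mulr_suml big_nat_cond [leRHS]big_nat_cond.
  apply: ler_sum => p /andP[/andP[lep _] _].
  rewrite mul1r lef_pV2 ?ler_nat ?posrE ?ltr0n ?expn_gt0 ?(ltnW lep) //.
  exact: leq_ltn_trans lep.
rewrite ler_pdivrMr ?ltr0n ?expn_gt0 // -mulrA [_^-1 * _]mulrC mulrA.
rewrite ler_pdivlMr ?ltr0n // -!natrM ler_nat -expnS mulnC.
exact: dyadic_prime_count.
Qed.

Lemma prime_sum_range_le i j : (0 < i)%N -> (i <= j)%N ->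
  \sum_((2 ^ i).+1 <= p < (2 ^ j).+1 | prime p) (p%:R)^-1
    <= 2 * (j - i)%:R * (i%:R)^-1 :> K.
Proof.
move=> i_gt0 /subnKC <-; elim: (j - i)%N => [|d IHd].
  by rewrite addn0 big_geq // subnn mulr0 mul0r.
rewrite (@big_cat_nat _ _ _ (2 ^ (i + d)).+1) ?ltnS ?leq_exp2l ?leq_addr ?leq_add2l //=.
rewrite addKn -[d.+1%:R]natr1 mulrDr mulr1 mulrDl; apply: lerD.
  by rewrite addKn in IHd.
rewrite addnS; apply: le_trans (dyadic_prime_sum_le _) _.
rewrite (_ : (_ == 0)%N = false) ?addr0; last by lia.
by rewrite ler_pM2l ?ltr0n // lef_pV2 ?posrE ?ltr0n ?ler_nat //; lia.
Qed.

(** Upper half of Mertens' theorem: the dyadic blocks contribute 2 / k each,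
    and the resulting harmonic sum up to 2 ^ m is at most m. *)
Lemma prime_sum_le m n : (n < 2 ^ m)%N ->
  \sum_(1 <= p < (2 ^ n.+1).+1 | prime p) (p%:R)^-1 <= 1 + 2 * m%:R :> K.
Proof.
move=> ltn2m.
have -> : \sum_(1 <= p < (2 ^ n.+1).+1 | prime p) (p%:R)^-1
    = \sum_(0 <= k < n.+1)
        \sum_((2 ^ k).+1 <= p < (2 ^ k.+1).+1 | prime p) (p%:R)^-1 :> K.
  elim: n {ltn2m} => [|n IHn].
    by rewrite big_nat1 big_ltn_cond.
  rewrite (@big_cat_nat _ _ _ (2 ^ n.+1).+1) ?ltnS ?leq_exp2l //= IHn.
  by rewrite [RHS]big_nat_recr.
apply: le_trans (ler_sum _ (fun k _ => dyadic_prime_sum_le k)) _.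
rewrite big_split /= addrC; apply: lerD.
  by rewrite big_nat_recl //= big1 ?addr0 // => k _; rewrite eqxx.
rewrite -mulr_sumr ler_pM2l ?ltr0n //.
apply: le_trans (harmonic_sum_le m).
rewrite big_nat_recl // invr0 add0r [leRHS](@big_cat_nat _ _ _ n.+1) //=.
rewrite big_add1 ler_wpDr //.
by apply: sumr_ge0 => s _; rewrite invr_ge0 ler0n.
Qed.
End Sums.

(** * The exponential e *)

Section Exponential.
Variable K : realType.
Implicit Types (x y : K) (z w : K[i]).
Local Open Scope complex_scope.

Lemma cabs_ge0 z : 0 <= cabs z.
Proof. by case: z => a b; rewrite sqrtr_ge0. Qed.

Lemma cabsM z w : cabs (z * w) = cabs z * cabs w.
Proof. exact: ComplexField.Normc.normcM. Qed.

Lemma cabsD z w : cabs (z + w) <= cabs z + cabs w.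
Proof. exact: le_normcD. Qed.

Lemma cabs_sum I (r : seq I) (P : pred I) (F : I -> K[i]) :
  cabs (\sum_(i <- r | P i) F i) <= \sum_(i <- r | P i) cabs (F i).
Proof.
elim/big_ind2: _ => [|z u w v lezu lewv|//]; first by rewrite /cabs ComplexField.Normc.normc0.
exact: le_trans (cabsD _ _) (lerD lezu lewv).
Qed.

Lemma eE x : e x = (cos (2 * pi * x)) +i* (sin (2 * pi * x)).
Proof.
have -> : e x = cexp (0 +i* (2 * pi * x)).
  by congr cexp; rewrite -[2](rmorph_nat (real_complex K)); simpc.
by rewrite /cexp /= expR0; simpc.
Qed.

Lemma eD x y : e (x + y) = e x * e y.
Proof. by rewrite !eE mulrDr cosD sinD; simpc; congr (_ +i* _); ring. Qed.

Lemma cabs_e x : cabs (e x) = 1.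
Proof. by rewrite eE /cabs /= cos2Dsin2 sqrtr1. Qed.

Lemma e0 : e 0 = 1 :> K[i].
Proof. by rewrite eE mulr0 cos0 sin0. Qed.

Lemma e_int (k : int) : e (k%:~R : K) = 1.
Proof.
have e_nat n : e (n%:R : K) = 1.
  elim: n => [|n IHn]; first exact: e0.
  rewrite -natr1 eD IHn mul1r eE mulr1.
  by rewrite mulr_natl cos2pi sin2pi.
case: (intP k) => [|n|n]; rewrite ?e0 //; first exact: e_nat.
have := eD (- n.+1%:R) n.+1%:R; rewrite addNr e0 e_nat mulr1 => ->.
by rewrite rmorphN.
Qed.


Lemma e_subint x (k : int) : e (x - k%:~R) = e x.
Proof. by rewrite -[in RHS](subrK k%:~R x) [RHS]eD e_int mulr1. Qed.

(** Multiplied by e x - 1, the sum telescopes. *)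
Lemma cabs_geometric_sum x M :
  cabs (\sum_(1 <= m < M.+1) e (x * m%:R)) * cabs (e x - 1) <= 2.
Proof.
rewrite -cabsM mulr_suml.
under eq_bigr do rewrite mulrBr mulr1 -eD -{2}[x]mulr1 -mulrDr natr1.
rewrite telescope_sumr //.
apply: le_trans (cabsD _ _) _.
by rewrite [X in _ + X]normcN -!/(cabs _) !cabs_e.
Qed.

(** For 1/4 <= |x| <= 1/2 the number e x has nonpositive real part. A smaller
    x is brought into this range by doubling, and |e (x + x) - 1| is
    at most 2 |e x - 1|. *)
Lemma cabs_e_sub1_ge x : `|x| <= 1 / 2 -> 2 * `|x| <= cabs (e x - 1).
Proof.
have far y : 1 / 4 <= `|y| -> `|y| <= 1 / 2 -> 1 <= cabs (e y - 1).
  move=> le4y ley2; have pi0 := pi_gt0 K.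
  have cos_le0 : cos (2 * pi * y) <= 0.
    have -> : cos (2 * pi * y) = cos (2 * pi * `|y|).
      by case: ger0P => // _; rewrite mulrN cosN.
    rewrite -[2 * pi * _](subrK (pi / 2)) cosDpihalf oppr_le0.
    by apply: sin_ge0_pi; nra.
  rewrite eE /cabs /= subr0 -[leLHS]sqrtr1 ler_sqrt.
    by have := cos2Dsin2 (2 * pi * y); nra.
  exact: addr_ge0 (sqr_ge0 _) (sqr_ge0 _).
have double y : cabs (e (y + y) - 1) <= 2 * cabs (e y - 1).
  have -> : e (y + y) - 1 = (e y + 1) * (e y - 1) by rewrite eD; ring.
  rewrite cabsM ler_wpM2r ?cabs_ge0 //.
  apply: le_trans (cabsD _ _) _.
  by rewrite cabs_e /cabs ComplexField.Normc.normc1.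
have main n y : 1 / 4 <= `|y| * 2 ^+ n -> `|y| <= 1 / 2 ->
    2 * `|y| <= cabs (e y - 1).
  elim: n y => [|n IHn] y le4y ley2.
    by rewrite expr0 mulr1 in le4y; have := far _ le4y ley2; lra.
  have [/far/(_ ley2)|lty4] := leP (1 / 4) `|y|; first by lra.
  have yy : `|y + y| = `|y| + `|y| by rewrite -mulr2n normrMn mulr2n.
  have := IHn (y + y); rewrite yy => IHyy.
  rewrite -(@ler_pM2l _ 2) //; apply: le_trans (double y).
  rewrite mulrDr in IHyy; rewrite mulr_natl mulr2n; apply: IHyy; last by lra.
  by rewrite exprS in le4y; lra.
have [->|x_neq0] := eqVneq x 0; first by rewrite normr0 mulr0 cabs_ge0.
have x_gt0 : 0 < `|x| by rewrite normr_gt0.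
apply: (main (Num.bound (1 / 4 / `|x|))).
rewrite [leRHS]mulrC -ler_pdivrMr //; apply: le_trans (ltW (archi_boundP _)) _.
  by rewrite divr_ge0.
by rewrite -natrX ler_nat ltnW // ltn_expl.
Qed.

End Exponential.

(** * Additive functions, Dirichlet approximation and residues *)

Section Arithmetic.
Variable K : realType.

(** Induction on n, splitting off the full power of its least prime divisor. *)
Lemma strongly_additive_sum_primes (f : nat -> K[i]) N n :
  strongly_additive f -> (0 < n <= N)%N ->
  f n = \sum_(1 <= p < N.+1 | prime p && (p %| n)%N) f p.
Proof.
move=> [addf powf]; elim/ltn_ind: n => n IHn /andP[n_gt0 lenN].
have f1 : f 1%N = 0.
  by have /(congr1 (fun z => z - f 1%N)) := addf 1 1 isT isT isT; rewrite mul1n addrK subrr.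
have [->|n_neq1] := eqVneq n 1%N.
  by rewrite f1 big1 // => p /andP[pr_p]; rewrite dvdn1 => /eqP p1; rewrite p1 in pr_p.
have n_gt1 : (1 < n)%N by lia.
have pr_p := pdiv_prime n_gt1; have p_dvd := pdiv_dvd n.
set p := pdiv n in pr_p p_dvd.
have [k [m [k_gt0 ncop nE]]] : exists k m, [/\ (0 < k)%N, ~~ (p %| m)%N & n = (m * p ^ k)%N].
  have [m] := pfactor_coprime pr_p n_gt0; rewrite prime_coprime // => ncop nE.
  by exists (logn p n), m; rewrite logn_gt0 mem_primes pr_p n_gt0.
have p_gt1 := prime_gt1 pr_p.
have m_gt0 : (0 < m)%N by move: n_gt0; rewrite nE muln_gt0 => /andP[].
have ltmn : (m < n)%N by rewrite nE ltn_Pmulr // -{1}(expn0 p) ltn_exp2l.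
have -> : f n = f p + f m.
  rewrite nE addf ?expn_gt0 ?(ltnW p_gt1) //; last first.
    by rewrite coprime_sym coprimeXl // prime_coprime.
  by rewrite powf // addrC.
rewrite (IHn m) //; last by rewrite m_gt0 (leq_trans (ltnW ltmn)).
have p_in : p \in index_iota 1 N.+1.
  by rewrite mem_index_iota ltnS (ltnW p_gt1) (leq_trans (dvdn_leq n_gt0 p_dvd)).
rewrite [in RHS]big_mkcond [RHS](bigD1_seq p) ?iota_uniq //= pr_p p_dvd /=.
rewrite -big_mkcondr; congr (_ + _); apply: eq_bigl => r.
case pr_r: (prime r); last by rewrite andbF.
have [->|neq_rp] /= := eqVneq r p; first by rewrite (negbTE ncop).
by rewrite nE Euclid_dvdM // Euclid_dvdX // (dvdn_prime2 pr_r pr_p) (negbTE neq_rp) orbF.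
Qed.

Lemma sum_multiples N d (G : nat -> K[i]) : (0 < d)%N ->
  \sum_(1 <= n < N.+1 | (d %| n)%N) G n =
  \sum_(1 <= m < (N %/ d).+1) G (d * m)%N.
Proof.
move=> d_gt0; elim: N => [|N IHN]; first by rewrite div0n !big_geq.
rewrite big_mkcond big_nat_recr //= -big_mkcond IHN divnS //.
case: ifP => [dvd|]; last by rewrite addr0.
rewrite add1n [RHS]big_nat_recr //=; congr (_ + G _).
have := divnS N d_gt0; rewrite dvd add1n => <-.
by rewrite mulnC divnK.
Qed.

Lemma additive_exponential_sum (f : nat -> K[i]) (Theta : K) N :
  strongly_additive f ->
  \sum_(1 <= n < N.+1) f n * e (Theta * n%:R) =
  \sum_(1 <= p < N.+1 | prime p)
    f p * \sum_(1 <= m < (N %/ p).+1) e (Theta * p%:R * m%:R).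
Proof.
move=> fP.
transitivity (\sum_(1 <= n < N.+1) \sum_(1 <= p < N.+1 | prime p)
    (if (p %| n)%N then f p * e (Theta * n%:R) else 0)).
  rewrite [LHS]big_nat_cond [RHS]big_nat_cond; apply: eq_bigr => n /andP[/andP[n_gt0 lenN] _].
  rewrite (@strongly_additive_sum_primes f N) ?n_gt0 // mulr_suml.
  by rewrite -big_mkcondr.
rewrite exchange_big /=; apply: eq_bigr => p pr_p.
rewrite -big_mkcond sum_multiples ?prime_gt0 // mulr_sumr.
by apply: eq_bigr => m _; rewrite natrM mulrA.
Qed.

(** Pigeonhole: among the Q + 1 fractional parts of d Theta, 0 <= d <= Q, two
    fall into the same interval of length 1 / Q. Dividing the resulting
    numerator and denominator by their gcd only improves the approximation. *)
Lemma dirichlet_approximation (Theta : K) Q : (0 < Q)%N ->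
  exists (a : int) (q : nat),
    [/\ (0 < q <= Q)%N, coprimez a q%:Z
      & `|q%:R * Theta - a%:~R| <= Q%:R^-1].
Proof.
move=> Q_gt0.
pose fr (d : nat) : K := d%:R * Theta - (Num.floor (d%:R * Theta))%:~R.
have fr_itv d : 0 <= fr d < 1.
  rewrite /fr subr_ge0 ltrBlDl floor_le /=.
  by have /andP[_] := floor_itv (d%:R * Theta); rewrite intrD.
have Q0 : 0 < Q%:R :> K by rewrite ltr0n.
have box_lt d : (`|Num.floor (Q%:R * fr d)|%N < Q)%N.
  have /andP[fr_ge0 fr_lt1] := fr_itv d.
  have fl_ge0 : 0 <= Num.floor (Q%:R * fr d) by rewrite floor_ge0 mulr_ge0 // ltW.
  rewrite -ltz_nat gez0_abs // -(ltr_int K).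
  by apply: le_lt_trans (floor_le _) _; rewrite -[ltRHS]mulr1 ltr_pM2l.
pose box (d : 'I_Q.+1) : 'I_Q := Ordinal (box_lt d).
have /injectivePn[i [j neq_ij eq_box]] : ~~ injectiveb box.
  by apply/injectiveP => /leq_card; rewrite !card_ord ltnn.
wlog lt_ij : i j neq_ij eq_box / (i < j)%N.
  move=> wl; have [lt|gt|/val_inj eq] := ltngtP i j; first exact: (wl i j).
    by apply: (wl j i); rewrite // eq_sym.
  by rewrite eq eqxx in neq_ij.
have eq_floor : Num.floor (Q%:R * fr i) = Num.floor (Q%:R * fr j).
  have [/andP[i0 _] /andP[j0 _]] := (fr_itv i, fr_itv j).
  have := congr1 (fun k : 'I_Q => (k%:Z)) eq_box; rewrite /= !gez0_abs //.
    by rewrite floor_ge0 mulr_ge0 // ltW.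
  by rewrite floor_ge0 mulr_ge0 // ltW.
have close : `|fr j - fr i| <= Q%:R^-1.
  have := floor_itv (Q%:R * fr i); have := floor_itv (Q%:R * fr j).
  rewrite eq_floor intrD => /andP[? ?] /andP[? ?].
  have : `|Q%:R * (fr j - fr i)| <= 1.
    by rewrite ler_norml mulrBr; apply/andP; split; lra.
  by rewrite normrM ger0_norm // -ler_pdivlMl // mulr1.
pose a0 := Num.floor (j%:R * Theta) - Num.floor (i%:R * Theta).
pose q0 := (j - i)%N.
have q0_gt0 : (0 < q0)%N by rewrite subn_gt0.
have q0_le : (q0 <= Q)%N by apply: leq_trans (leq_subr _ _) _; rewrite -ltnS.
have {}close : `|q0%:R * Theta - a0%:~R| <= Q%:R^-1.
  move: close; congr (`|_| <= _).
  by rewrite /fr /a0 /q0 natrB ?(ltnW lt_ij) // intrB; ring.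
pose g := gcdn `|a0| q0.
have g_gt0 : (0 < g)%N by rewrite gcdn_gt0 q0_gt0 orbT.
have [a a0E] : exists a, a0 = a * g%:Z.
  by apply/dvdzP; rewrite dvdzE /= dvdn_gcdl.
have [q q0E] : exists q, q0 = (q * g)%N.
  by apply/dvdnP; rewrite dvdn_gcdr.
exists a, q; split.
- rewrite -(@ltn_pmul2r g) // mul0n -q0E q0_gt0 /=.
  by apply: leq_trans q0_le; rewrite q0E leq_pmulr.
- have [u [v]] := Bezoutz a0 q0%:Z; rewrite /gcdz /= -/g => uv.
  apply/coprimezP; exists (u, v) => /=.
  apply: (@mulIf _ g%:Z); first by lia.
  rewrite mul1r -[RHS]uv (_ : q0%:Z = q%:Z * g%:Z); last by rewrite -PoszM -q0E.
  by rewrite [X in _ = u * X + _]a0E; ring.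
- apply: le_trans close; rewrite a0E q0E natrM intrM.
  have -> : q%:R * g%:R * Theta - a%:~R * g%:R = g%:R * (q%:R * Theta - a%:~R) by ring.
  by rewrite normrM ler_peMl // ger0_norm // ler1n.
Qed.

(** Multiplication by b permutes the residues mod q, so that every block of q
    consecutive integers contributes the same full sum. *)
Lemma sum_residues_le (w : nat -> K) b q D :
  (0 < q)%N -> coprime b q -> (forall s, 0 <= w s) ->
  \sum_(0 <= d < D) w ((b * d) %% q)%N
    <= (D %/ q).+1%:R * \sum_(0 <= s < q) w s.
Proof.
move=> q_gt0 cop w_ge0.
have block c : \sum_(c <= d < c + q) w ((b * d) %% q)%N = \sum_(0 <= s < q) w s.
  elim: c => [|c <-].
    rewrite add0n !big_mkord.
    pose h (i : 'I_q) : 'I_q := Ordinal (ltn_pmod (b * i) q_gt0).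
    rewrite [RHS](reindex_inj (h := h)) // => i j /(congr1 val) /= /eqP.
    wlog le_ji : i j / (j <= i)%N.
      by move=> wl; have [/wl wl'|/ltnW/wl //] := leqP i j; rewrite eq_sym => /wl' <-.
    rewrite eqn_mod_dvd ?leq_mul2l ?le_ji ?orbT // -mulnBr Gauss_dvdr 1?coprime_sym //.
    move=> dvd_ij; apply/val_inj/eqP; rewrite eqn_leq le_ji andbT -subn_eq0.
    apply: contraLR dvd_ij; rewrite -lt0n => /gtnNdvd-> //.
    exact: leq_ltn_trans (leq_subr _ _) (ltn_ord i).
  have lt_c : (c < c + q)%N by rewrite -addn1 leq_add2l.
  rewrite addSn big_nat_recr //= [RHS]big_ltn // addrC.
  by rewrite mulnDr addnC modnMDl.
have blocks k : \sum_(0 <= d < k * q) w ((b * d) %% q)%N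
    = k%:R * \sum_(0 <= s < q) w s.
  elim: k => [|k IHk]; first by rewrite mul0n big_geq // mul0r.
  rewrite mulSn addnC (@big_cat_nat _ _ _ (k * q)) ?leq_addr //= IHk block.
  by rewrite -natr1 mulrDl mul1r.
rewrite -blocks [leRHS](@big_cat_nat _ _ _ D) //=; last by rewrite ltnW // ltn_ceil.
by rewrite ler_wpDr // sumr_ge0.
Qed.

(** As |t| <= 1 / 2 <= min(s, q - s) / 2, the point (s + t) / q keeps at least
    half of the distance min(s, q - s) / q of s / q to the integers. Adding the
    inverses of s and q - s, instead of taking the inverse of their minimum,
    makes the bound easy to sum over s. *)
Lemma cabs_e_near_fraction_ge (s q : nat) (t : K) :
  (0 < s < q)%N -> `|t| <= 1 / 2 ->
  1 <= q%:R * ((s%:R)^-1 + ((q - s)%:R)^-1)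
       * cabs (e ((s%:R + t) / q%:R) - 1).
Proof.
move=> /andP[s_gt0 lt_sq] /ler_normlP[t_ge t_le].
have s1 : 1 <= s%:R :> K by rewrite ler1n.
have sq : s%:R + 1 <= q%:R :> K by rewrite natr1 ler_nat.
rewrite natrB ?(ltnW lt_sq) //.
move: (s%:R) (q%:R) s1 sq => {s_gt0 lt_sq} x y x1 xy.
have y0 : 0 < y by lra.
have x0 : 0 < x by lra.
have yx0 : 0 < y - x by lra.
set r := cabs _.
suff [le_x|le_yx] : x / y <= r \/ (y - x) / y <= r.
- have r0 : 0 < r by apply: lt_le_trans le_x; rewrite divr_gt0.
  rewrite ler_pdivrMr // in le_x.
  have -> : y * (x^-1 + (y - x)^-1) * r = r * y / x + r * y / (y - x) by ring.
  by apply: ler_wpDr; [rewrite ltW // divr_gt0 ?mulr_gt0 | rewrite ler_pdivlMr // mul1r].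
- have r0 : 0 < r by apply: lt_le_trans le_yx; rewrite divr_gt0.
  rewrite ler_pdivrMr // in le_yx.
  have -> : y * (x^-1 + (y - x)^-1) * r = r * y / x + r * y / (y - x) by ring.
  by apply: ler_wpDl; [rewrite ltW // divr_gt0 ?mulr_gt0 | rewrite ler_pdivlMr // mul1r].
have [le2|lt2] := leP ((x + t) / y) (1 / 2).
  left; have xt0 : 0 <= (x + t) / y by rewrite divr_ge0 //; lra.
  have := @cabs_e_sub1_ge K ((x + t) / y); rewrite ger0_norm // -/r => /(_ le2).
  apply: le_trans; rewrite mulrA ler_pM2r ?invr_gt0 //; lra.
right; have E : 1 - (x + t) / y = (y - x - t) / y.
  by field; rewrite gt_eqF.
have xt0 : 0 <= 1 - (x + t) / y by rewrite E divr_ge0 //; lra.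
have := @cabs_e_sub1_ge K ((x + t) / y - 1%:~R).
rewrite e_subint distrC ger0_norm // -/r => /(_ ltac:(lra)).
by apply: le_trans; rewrite E mulrA ler_pM2r ?invr_gt0 //; lra.
Qed.

End Arithmetic.

(** * The geometric sums over multiples of p *)

Section PrimeMultiples.
Variable K : realType.
Implicit Types (Theta R : K) (a : int) (N D p q : nat).

Definition multiples_sum Theta N p : K[i] :=
  \sum_(1 <= m < (N %/ p).+1) e (Theta * p%:R * m%:R).

Lemma cabs_multiples_sum_le Theta N p : (0 < p)%N ->
  cabs (multiples_sum Theta N p) <= N%:R / p%:R.
Proof.
move=> p_gt0; apply: le_trans (cabs_sum _ _ _) _.
under eq_bigr do rewrite cabs_e.
rewrite sumr_const_nat subn1 /= ler_pdivlMr ?ltr0n // -natrM ler_nat.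
exact: leq_trunc_div.
Qed.

Lemma cabs_multiples_sum_geometric Theta N p (B : K) :
  2 <= B * cabs (e (Theta * p%:R) - 1) -> cabs (multiples_sum Theta N p) <= B.
Proof.
move=> le2; have c0 : 0 < cabs (e (Theta * p%:R) - 1).
  rewrite lt_def cabs_ge0 andbT; apply: contraTneq le2 => ->.
  by rewrite mulr0 -ltNge.
by rewrite -(ler_pM2r c0) (le_trans (cabs_geometric_sum _ _)).
Qed.

(** A sum over a full period of residues, dominated by twice a harmonic sum:
    one half for each of the two neighbouring integers. *)
Lemma sum_inv_distance_le q k : (q <= 2 ^ k)%N ->
  \sum_(1 <= s < q) ((s%:R)^-1 + ((q - s)%:R)^-1) <= 2 * k%:R :> K.
Proof.
move=> leq2k; have [q0|q_gt0] := posnP q.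
  by rewrite q0 big_geq // mulr_ge0.
have half : \sum_(1 <= s < q) (s%:R)^-1 <= k%:R :> K.
  apply: le_trans (harmonic_sum_le K k).
  rewrite [leRHS](@big_cat_nat _ _ _ q) //= ler_wpDr //.
  by apply: sumr_ge0 => s _; rewrite invr_ge0.
rewrite big_split /= [X in _ + X]big_nat_rev /=.
have -> : \sum_(1 <= s < q) ((q - (1 + q - s.+1))%:R)^-1
    = \sum_(1 <= s < q) (s%:R)^-1 :> K.
  rewrite big_nat_cond [RHS]big_nat_cond; apply: eq_bigr => s /andP[/andP[_ ltsq] _].
  by rewrite add1n subSS subKn // ltnW.
by rewrite mulr_natl mulr2n lerD.
Qed.

(** Since |Theta q - a| d <= 1 / 2 for d <= D, the phase Theta d stays near
    a d / q, whose distance to the integers runs through the residues s / q;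
    hence a whole period costs only O(k q), whatever the size of q. *)
Lemma sum_nonmultiples_le Theta N D a q k :
  (0 < D)%N -> (0 < q)%N -> (q <= 2 ^ k)%N -> coprimez a q%:Z ->
  `|q%:R * Theta - a%:~R| <= ((2 * D)%:R)^-1 ->
  \sum_(1 <= d < D.+1 | ~~ (q %| d)%N) cabs (multiples_sum Theta N d)
    <= 4 * k%:R * (D.+1 + q)%:R.
Proof.
move=> D_gt0 q_gt0 leq2k cop close.
pose b := `|(a %% q)%Z|%N.
have bE : b%:Z = (a %% q)%Z by rewrite /b gez0_abs // modz_ge0 //; lia.
have copb : coprime b q.
  by move: cop; rewrite /coprimez -gcdz_modl -bE.
pose w s : K := if (s == 0)%N then 0
  else 2 * q%:R * ((s%:R)^-1 + ((q - s)%:R)^-1).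
have w_ge0 s : 0 <= w s.
  by rewrite /w; case: ifP => // _; rewrite !mulr_ge0 // addr_ge0 ?invr_ge0.
apply: (@le_trans _ _ (\sum_(0 <= d < D.+1) w ((b * d) %% q)%N)).
  rewrite big_mkcond /= [leRHS]big_ltn // ler_wpDl //.
  rewrite big_nat_cond [leRHS]big_nat_cond; apply: ler_sum => d.
  rewrite andbT => /andP[d_gt0 led]; case: ifP => // ndvd.
  pose s := ((b * d) %% q)%N; pose t := (q%:R * Theta - a%:~R) * d%:R.
  have s_gt0 : (0 < s)%N.
    by rewrite lt0n; apply: contra ndvd => /eqP s0; rewrite -(@Gauss_dvdr q b) 1?coprime_sym // /dvdn -/s s0.
  have lt_sq : (s < q)%N by rewrite ltn_pmod.
  have lt2 : `|t| <= 1 / 2.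
    rewrite /t normrM [`|d%:R|]ger0_norm //.
    apply: le_trans (ler_wpM2r _ close) _ => //.
    rewrite mulrC ler_pdivrMr ?ltr0n ?muln_gt0 //.
    by rewrite natrM mulrA divfK ?mul1r ?ler_nat // pnatr_eq0.
  have q0 : q%:R != 0 :> K by rewrite pnatr_eq0 -lt0n.
  have phase : e (Theta * d%:R) = e ((s%:R + t) / q%:R).
    have aE : (a%:~R : K) = (a %/ q)%Z%:~R * q%:R + b%:R.
      by rewrite {1}(divz_eq a q%:Z) -bE intrD intrM.
    have bdE : b%:R * d%:R = ((b * d) %/ q)%N%:R * q%:R + s%:R :> K.
      by rewrite -!natrM -natrD -divn_eq.
    (* z is the integer by which Theta d exceeds (s + t) / q. *)
    pose z := (a %/ q)%Z * d%:Z + ((b * d) %/ q)%N%:Z.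
    rewrite -(e_subint _ z); congr e.
    rewrite /z intrD intrM /t aE.
    apply: (mulIf q0); rewrite divfK // -[s%:R](addKr (((b * d) %/ q)%N%:R * q%:R)) -bdE.
    by rewrite -!pmulrn; ring.
  rewrite -/s /w (gtn_eqF s_gt0); apply: cabs_multiples_sum_geometric.
  by rewrite phase -!mulrA ler_peMr // mulrA cabs_e_near_fraction_ge // s_gt0.
apply: le_trans (sum_residues_le _ q_gt0 copb w_ge0) _.
have sum_w : \sum_(0 <= s < q) w s <= 4 * k%:R * q%:R.
  rewrite big_ltn // {1}/w eqxx add0r.
  have -> : \sum_(1 <= s < q) w s
      = 2 * q%:R * \sum_(1 <= s < q) ((s%:R)^-1 + ((q - s)%:R)^-1).
    rewrite mulr_sumr big_nat_cond [RHS]big_nat_cond.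
    by apply: eq_bigr => s /andP[/andP[s_gt0 _] _]; rewrite /w gtn_eqF.
  apply: (@le_trans _ _ (2 * q%:R * (2 * k%:R))); last by lra.
  by rewrite ler_wpM2l ?mulr_ge0 // sum_inv_distance_le.
apply: le_trans (ler_wpM2l _ sum_w) _ => //.
rewrite mulrCA ler_wpM2l ?mulr_ge0 // -natrM ler_nat mulSn addnC leq_add2r.
exact: leq_trunc_div.
Qed.

(** Two distinct fractions a / q and a1 / q1 differ by at least 1 / (q q1),
    and Theta is within 1 / q ^ 2 of the first: if q1 < q / 2, it must stay
    away from the second. If the fractions are equal, then q divides
    q1, so that q <= q1. *)
Lemma approximation_dichotomy Theta a q a1 q1 :
  (0 < q)%N -> (0 < q1)%N -> coprimez a q%:Z ->
  `|Theta - a%:~R / q%:R| <= 1 / q%:R ^+ 2 ->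
  q%:R / 2 <= q1%:R :> K \/ (2 * q%:R)^-1 <= `|q1%:R * Theta - a1%:~R|.
Proof.
move=> q_gt0 q1_gt0 cop close.
have q0 : 0 < q%:R :> K by rewrite ltr0n.
have q10 : 0 < q1%:R :> K by rewrite ltr0n.
have [eq|neq] := eqVneq (a * q1%:Z) (a1 * q%:Z).
  left; have : (q %| q1)%N.
    have : (q%:Z %| a * q1%:Z)%Z by rewrite eq dvdz_mull.
    by rewrite Gauss_dvdzr // coprimez_sym.
  move/(dvdn_leq q1_gt0); rewrite -(ler_nat K); lra.
have gap : 1 <= `|a%:~R * q1%:R - a1%:~R * q%:R| :> K.
  have : 1 <= `|a * q1%:Z - a1 * q%:Z| by rewrite -gtz0_ge1 normr_gt0 subr_eq0.
  by rewrite -(ler_int K) intr_norm intrB !intrM.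
have [|lt1] := leP (q%:R / 2) (q1%:R : K); first by left.
right; rewrite invfM ler_pdivrMr //.
have close' : q%:R * `|Theta - a%:~R / q%:R| <= 1 / q%:R.
  rewrite mulrC -ler_pdivlMr //; apply: le_trans close _.
  by rewrite expr2 invfM mulrA.
have tri : 1 <= q1%:R * (q%:R * `|Theta - a%:~R / q%:R|)
                + `|q1%:R * Theta - a1%:~R| * q%:R.
  apply: le_trans gap _.
  have -> : a%:~R * q1%:R - a1%:~R * q%:R = - (q1%:R * (q%:R * (Theta - a%:~R / q%:R)))
      + (q1%:R * Theta - a1%:~R) * q%:R.
    by field; rewrite gt_eqF.
  apply: le_trans (ler_normD _ _) _.
  by rewrite normrN !normrM ![`|_%:R|]ger0_norm.
have : q1%:R * (q%:R * `|Theta - a%:~R / q%:R|) <= 1 / 2.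
  apply: le_trans (ler_wpM2l (ltW q10) close') _.
  by rewrite mulrA mulr1 ler_pdivrMr //; lra.
by lra.
Qed.

(** A large q1 makes the sum short, and if Theta q1 is far from a1 the sum
    oscillates; the phase Theta k q1 is k times as far from k a1, since
    k <= D keeps it in the range where distances scale. *)
Lemma cabs_multiples_sum_denominator_le Theta R N D a q a1 q1 k :
  (0 < q)%N -> coprimez a q%:Z ->
  `|Theta - a%:~R / q%:R| <= 1 / q%:R ^+ 2 ->
  0 < R -> R <= q%:R -> q%:R <= N%:R / R ->
  (0 < q1)%N -> (0 < k)%N -> (k * q1 <= D)%N ->
  `|q1%:R * Theta - a1%:~R| <= ((2 * D)%:R)^-1 ->
  cabs (multiples_sum Theta N (k * q1)) <= 2 * N%:R / R / k%:R.
Proof.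
move=> q_gt0 cop close R0 leRq leqN q1_gt0 k_gt0 leD close1.
have q0 : 0 < q%:R :> K by rewrite ltr0n.
have q10 : 0 < q1%:R :> K by rewrite ltr0n.
have k0 : 0 < k%:R :> K by rewrite ltr0n.
have qR : q%:R * R <= N%:R by rewrite -ler_pdivlMr.
have N0 : 0 < N%:R :> K by apply: lt_le_trans qR; rewrite mulr_gt0.
have [le_q1|far] := approximation_dichotomy a1 q_gt0 q1_gt0 cop close.
  apply: le_trans (cabs_multiples_sum_le _ _ _) _; first by rewrite muln_gt0 k_gt0.
  rewrite natrM invfM mulrA [_ / k%:R / _]mulrAC ler_pM2r ?invr_gt0 //.
  by rewrite ler_pdivrMr // mulrAC ler_pdivlMr //; nra.
pose t := q1%:R * Theta - a1%:~R.
have kt : `|k%:R * t| <= 1 / 2.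
  rewrite normrM [`|k%:R|]ger0_norm //.
  apply: le_trans (ler_wpM2l (ltW k0) close1) _.
  have le_kD : (k <= D)%N by apply: leq_trans leD; rewrite leq_pmulr.
  have D0 : 0 < D%:R :> K by rewrite ltr0n (leq_trans k_gt0).
  rewrite natrM ler_pdivrMr ?mulr_gt0 // mulrA divfK // mul1r.
  by rewrite ler_nat.
have phase : e (Theta * (k * q1)%:R) = e (k%:R * t).
  rewrite -(e_subint _ (k%:Z * a1)) intrM natrM; congr e.
  by rewrite /t -pmulrn; ring.
apply: cabs_multiples_sum_geometric; rewrite phase.
apply: le_trans (ler_wpM2l _ (cabs_e_sub1_ge kt)); last first.
  by rewrite !divr_ge0 // ?mulr_ge0 // ltW.
rewrite normrM [`|k%:R|]ger0_norm //.
have -> : 2 * N%:R / R / k%:R * (2 * (k%:R * `|t|)) = 4 * (`|t| * N%:R / R).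
  by field; rewrite !gt_eqF.
suff : 1 / 2 <= `|t| * N%:R / R by lra.
rewrite ler_pdivlMr //; rewrite -/t invfM ler_pdivrMr // in far.
have t0 := normr_ge0 t; nra.
Qed.

End PrimeMultiples.

(** * Assembly of the estimates *)

Section Assembly.
Variable K : realType.
Implicit Types (Theta R C : K) (a : int) (N q : nat).

(** The primes divisible by q1 > 1 reduce to q1 itself, which gives the term 1;
    for q1 = 1 all primes occur, and the sum of their inverses appears. *)
Lemma sum_prime_multiples_le Theta R N D a q a1 q1 :
  (0 < q)%N -> coprimez a q%:Z ->
  `|Theta - a%:~R / q%:R| <= 1 / q%:R ^+ 2 ->
  0 < R -> R <= q%:R -> q%:R <= N%:R / R ->
  (0 < q1)%N -> `|q1%:R * Theta - a1%:~R| <= ((2 * D)%:R)^-1 ->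
  \sum_(1 <= p < D.+1 | prime p && (q1 %| p)%N) cabs (multiples_sum Theta N p)
    <= 2 * N%:R / R * (1 + \sum_(1 <= p < D.+1 | prime p) (p%:R)^-1).
Proof.
move=> q_gt0 cop close R0 leRq leqN q1_gt0 close1.
have B0 : 0 <= 2 * N%:R / R by rewrite divr_ge0 ?mulr_ge0 // ltW.
apply: (@le_trans _ _ (\sum_(1 <= p < D.+1 | prime p && (q1 %| p)%N)
    2 * N%:R / R * ((p == q1)%:R + (p%:R)^-1))).
  rewrite big_nat_cond [leRHS]big_nat_cond; apply: ler_sum => p.
  move=> /andP[/andP[p_gt0 leD] /andP[pr_p /dvdnP[k pE]]].
  have k_gt0 : (0 < k)%N by move: p_gt0; rewrite pE muln_gt0 => /andP[].
  rewrite pE; apply: le_trans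
    (cabs_multiples_sum_denominator_le q_gt0 cop close R0 leRq leqN q1_gt0 k_gt0 _ close1) _.
    by rewrite -pE.
  rewrite ler_wpM2l //.
  (* As p is prime, either q1 = 1 and k = p, or q1 = p and k = 1. *)
  have : (q1 %| p)%N by rewrite pE dvdn_mull.
  case/primeP: pr_p => _ dvd_p /dvd_p /orP[/eqP q1E|/eqP q1E].
    by rewrite q1E muln1 lerDr.
  have -> : k = 1%N by apply/eqP; rewrite -(eqn_pmul2r q1_gt0) mul1n -pE q1E.
  by rewrite mul1n eqxx invr1 lerDl invr_ge0.
rewrite -mulr_sumr ler_wpM2l // big_split /=; apply: lerD.
  apply: (@le_trans _ _ (\sum_(1 <= p < D.+1 | p == q1) 1)).
    rewrite big_mkcond [leRHS]big_mkcond; apply: ler_sum => p _.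
    by case: eqP => _; case: ifP.
  rewrite big_const_seq iter_addr_0 (_ : count _ _ = count_mem q1 (index_iota 1 D.+1)) //.
  by rewrite count_uniq_mem ?iota_uniq //; case: (_ \in _).
rewrite big_mkcond [leRHS]big_mkcond; apply: ler_sum => p _.
by case: (prime p) => //=; case: ifP => // _; rewrite invr_ge0.
Qed.

(** The threshold D of the three ranges is 2 ^ i; the summands bound the
    primes p <= D not divisible by the Dirichlet denominator, those divisible
    by it, and the primes p > D. *)
Lemma additive_exponential_sum_le (f : nat -> K[i]) C Theta R N a q n i m :
  strongly_additive f -> 0 <= C -> (forall p, prime p -> cabs (f p) <= C) ->
  (0 < q)%N -> coprimez a q%:Z ->
  `|Theta - a%:~R / q%:R| <= 1 / q%:R ^+ 2 ->
  0 < R -> R <= q%:R -> q%:R <= N%:R / R ->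
  (2 ^ n <= N < 2 ^ n.+1)%N -> (0 < i <= n)%N -> (i <= 2 ^ m)%N ->
  cabs (\sum_(1 <= k < N.+1) f k * e (Theta * k%:R))
    <= C * (4 * i.+1%:R * (3 * 2 ^ i + 1)%:R
            + 2 * N%:R / R * (2 + 2 * m%:R)
            + N%:R * (2 * (n.+1 - i)%:R / i%:R)).
Proof.
move=> fP C_ge0 f_le q_gt0 cop close R0 leRq leqN /andP[leN ltN] /andP[i_gt0 lein] leim.
pose D := (2 ^ i)%N.
have D_gt0 : (0 < D)%N by rewrite expn_gt0.
have leDN : (D <= N)%N by apply: leq_trans leN; rewrite leq_exp2l.
have B0 : 0 <= 2 * N%:R / R by rewrite divr_ge0 ?mulr_ge0 // ltW.
have [a1 [q1 [/andP[q1_gt0 leq1] cop1 close1]]] :=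
  @dirichlet_approximation K Theta (2 * D) ltac:(lia).
rewrite additive_exponential_sum //.
apply: le_trans (cabs_sum _ _ _) _.
apply: (@le_trans _ _ (C * \sum_(1 <= p < N.+1 | prime p)
    cabs (multiples_sum Theta N p))).
  rewrite mulr_sumr; apply: ler_sum => p pr_p.
  by rewrite cabsM ler_wpM2r ?cabs_ge0 // f_le.
rewrite ler_wpM2l // (@big_cat_nat _ _ _ D.+1) //=.
rewrite (bigID (fun p => q1 %| p)%N) /= [X in X + _]addrC.
apply: lerD; first apply: lerD.
- apply: (@le_trans _ _ (\sum_(1 <= d < D.+1 | ~~ (q1 %| d)%N)
      cabs (multiples_sum Theta N d))).
    rewrite big_mkcond [leRHS]big_mkcond; apply: ler_sum => p _.
    by case: (prime p) => //=; case: ifP => // _; apply: cabs_ge0.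
  apply: le_trans (sum_nonmultiples_le N D_gt0 q1_gt0 _ cop1 close1) _.
    by apply: leq_trans leq1 _; rewrite -expnS.
  by rewrite ler_wpM2l ?mulr_ge0 // ler_nat -/D; lia.
- apply: le_trans (sum_prime_multiples_le q_gt0 cop close R0 leRq leqN q1_gt0 close1) _.
  rewrite ler_wpM2l //; have := @prime_sum_le K m i.-1.
  by rewrite (prednK i_gt0) => /(_ leim); lra.
- apply: (@le_trans _ _ (N%:R * \sum_(D.+1 <= p < N.+1 | prime p) (p%:R)^-1)).
    rewrite mulr_sumr; apply: ler_sum => p pr_p.
    by rewrite cabs_multiples_sum_le // prime_gt0.
  rewrite ler_wpM2l //.
  have := @prime_sum_range_le K i n.+1 i_gt0 (leqW lein); apply: le_trans.
  rewrite [leRHS](@big_cat_nat _ _ _ N.+1) //=; last by rewrite ltnW.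
  by rewrite ler_wpDr // sumr_ge0 // => p _; rewrite invr_ge0.
Qed.

Lemma ln2_ge_half : 1 / 2 <= ln 2 :> K.
Proof.
rewrite -[ln 2]opprK -lnV ?posrE // lerNr.
have := @le_ln1Dx K (- (1 / 2)) ltac:(lra).
have -> : 1 + - (1 / 2) = 2^-1 :> K by lra.
by lra.
Qed.

Lemma ln2_le1 : ln 2 <= 1 :> K.
Proof. by have := @le_ln1Dx K 1 ltac:(lra). Qed.

Lemma ln_natX2 k : ln ((2 ^ k)%:R : K) = ln 2 * k%:R.
Proof. by rewrite natrX lnXn // mulr_natr. Qed.

Lemma ln_dyadic_bounds N n : (2 ^ n <= N < 2 ^ n.+1)%N ->
  n%:R / 2 <= ln (N%:R : K) <= n.+1%:R.
Proof.
move=> /andP[leN ltN]; have N0 : (0 < N)%N by apply: leq_trans leN; rewrite expn_gt0.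
have l2 := ln2_ge_half; have l1 := ln2_le1; apply/andP; split.
  apply: (@le_trans _ _ (ln (2 ^ n)%:R)).
    rewrite ln_natX2; have := ler0n K n; nra.
  by rewrite ler_ln ?posrE ?ltr0n ?expn_gt0 // ler_nat.
apply: (@le_trans _ _ (ln (2 ^ n.+1)%:R)).
  by rewrite ler_ln ?posrE ?ltr0n ?expn_gt0 // ler_nat ltnW.
by rewrite ln_natX2 ler_piMl.
Qed.

Lemma lnln_dyadic_ge N n m : (2 ^ n <= N)%N -> (2 ^ m.+1 <= n)%N ->
  m%:R / 2 <= ln (ln (N%:R : K)).
Proof.
move=> leN len; have l2 := ln2_ge_half.
have lenL : (2 ^ m)%:R <= ln (N%:R : K).
  have := @ln_dyadic_bounds N (trunc_log 2 N).
  have N0 : (0 < N)%N by apply: leq_trans leN; rewrite expn_gt0.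
  rewrite trunc_logP // trunc_log_ltn // => /(_ isT)/andP[+ _].
  apply: le_trans; rewrite ler_pdivlMr // -natrM ler_nat mulnC -expnS.
  by apply: leq_trans len _; rewrite trunc_log_max.
apply: (@le_trans _ _ (ln (2 ^ m)%:R)).
  by rewrite ln_natX2; have := ler0n K m; nra.
by rewrite ler_ln ?posrE ?ltr0n ?expn_gt0 // (lt_le_trans _ lenL) // ltr0n expn_gt0.
Qed.

Lemma inv_le_ln_powR_div R : 2 <= R ->
  R^-1 <= 4 * (ln R `^ (3 / 2) / R `^ (1 / 2)).
Proof.
move=> R2; have R0 : 0 < R by lra.
have r0 : 0 < R `^ (1 / 2) by rewrite powR_gt0.
have rR : R `^ (1 / 2) <= R by rewrite ler1_powR //; lra.
have lnR : 1 / 2 <= ln R by apply: le_trans ln2_ge_half _; rewrite ler_ln ?posrE.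
have pow : 1 / 4 <= ln R `^ (3 / 2).
  have -> : 1 / 4 = (1 / 2 : K) `^ 2%:R by rewrite powR_mulrn //; lra.
  apply: (@le_trans _ _ ((1 / 2) `^ (3 / 2))).
    by apply: ger_powR; lra.
  by apply: ge0_ler_powR => //; rewrite ?nnegrE; lra.
rewrite mulrA ler_pdivlMr //.
apply: (@le_trans _ _ 1); last by lra.
by rewrite [leLHS]mulrC ler_pdivrMr // [leRHS]mul1r.
Qed.

Lemma leq_4n_expn2 k : (4 * (6 + k) <= 2 ^ (5 + k))%N.
Proof.
elim: k => // k IHk; rewrite !addnS expnS mulnS.
by have : (4 <= 2 ^ (5 + k))%N; lia.
Qed.

End Assembly.

Theorem theorem1p2 (K : realType) (C A2 A3 : K) (N0 : nat) :
  1 <= C ->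
  exists (c : K) (N1 : nat),
  forall f : nat -> K[i],
    strongly_additive f ->
    (forall p : nat, prime p -> cabs (f p) <= C) ->
    (forall N : nat, (N0 <= N)%N ->
       \sum_(1 <= n < N.+1) cabs (f n) <= A2 * `|N%:R * ln (ln N%:R)|) ->
    (forall N : nat, (N0 <= N)%N ->
       \sum_(1 <= n < N.+1) cabs (f n) ^+ 2
         <= A3 * `|N%:R * ln (ln N%:R) ^+ 2|) ->
  forall (Theta : K) (a : int) (q N : nat) (R : K),
    (N1 <= N)%N ->
    (0 < q)%N ->
    coprimez a q%:Z ->
    `|Theta - a%:~R / q%:R| <= 1 / q%:R ^+ 2 ->
    2 <= R -> R <= q%:R -> q%:R <= N%:R / R ->
    cabs (\sum_(1 <= n < N.+1) f n * e (Theta * n%:R))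
      <= c * `|N%:R * ln (ln N%:R) / ln N%:R
               + N%:R * ln (ln N%:R) * (ln R) `^ (3 / 2) / R `^ (1 / 2)|.
Proof.
move=> C1; exists (128 * C), (2 ^ 32)%N => f fP f_le _ _ Theta a q N R.
move=> leN1 q_gt0 cop close R2 leRq leqN.
have N_gt0 : (0 < N)%N by apply: leq_trans leN1; rewrite expn_gt0.
(* Here n is of the size of ln N, and m below of the size of ln (ln N). *)
have {leN1} [n n_ge nN] : exists2 n, (32 <= n)%N & (2 ^ n <= N < 2 ^ n.+1)%N.
  exists (trunc_log 2 N); first exact: trunc_log_max.
  by rewrite trunc_logP // trunc_log_ltn.
have n_gt0 : (0 < n)%N by lia.
have [m [m_ge m_le m_gt m4]] : exists m,
    [/\ (4 <= m)%N, (2 ^ m.+1 <= n)%N, (n < 2 ^ m.+2)%N & (4 * m.+2 <= n)%N].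
  exists (trunc_log 2 n).-1.
  have k5 : (5 <= trunc_log 2 n)%N by apply: trunc_log_max => //; apply: leq_trans n_ge.
  have le_n := trunc_logP (isT : (1 < 2)%N) n_gt0.
  have lt_n := trunc_log_ltn n (isT : (1 < 2)%N).
  rewrite prednK; last by lia.
  split=> //; first by lia.
  have := leq_4n_expn2 (trunc_log 2 n - 5); rewrite subnKC // => /leq_trans/(_ le_n).
  by apply: leq_trans; lia.
(* As n < 2 ^ m.+2, the choice D = 2 ^ i gives D <= N / n ^ 2. *)
have [i nE] : exists i, n = (m.+2 + m.+2 + i)%N.
  by exists (n - (m.+2 + m.+2))%N; lia.
have i_itv : (0 < i <= n)%N by lia.
have i_lt : (i.+1 <= n)%N by lia.
have m_lin : (8 * m.+2 + 4 <= 12 * m.+2)%N by lia.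
have n_le2i : (n <= 2 * i)%N by lia.
have diE : (n.+1 - i = 2 * m.+2 + 1)%N by lia.
have i_le : (i <= 2 ^ m.+2)%N by lia.
have R0 : 0 < R by lra.
have := additive_exponential_sum_le fP (le_trans ler01 C1) f_le q_gt0 cop close
  R0 leRq leqN nN i_itv i_le.
move=> /le_trans; apply.
have /andP[L_ge L_le] := ln_dyadic_bounds K nN.
have LL_ge : m%:R / 2 <= ln (ln (N%:R : K)).
  by apply: (@lnln_dyadic_ge K N n) => //; case/andP: nN.
set L := ln N%:R in L_ge L_le LL_ge *; set LL := ln L in LL_ge *.
have n0 : 0 < n%:R :> K by rewrite ltr0n.
have n32 : 32 <= n%:R :> K by rewrite ler_nat.
have Nr : 0 < N%:R :> K by rewrite ltr0n.
have L0 : 0 < L by apply: lt_le_trans L_ge; rewrite divr_gt0.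
have m4r : 4 <= m%:R :> K by rewrite ler_nat.
have m2E : m.+2%:R = m%:R + 2 :> K by rewrite -addn2 natrD.
have LL_m : m.+2%:R <= 4 * LL by lra.
have LL1 : 1 <= LL by lra.
have invn : n%:R^-1 <= 2 / L.
  by rewrite ler_pdivlMr // mulrC ler_pdivrMr //; rewrite -natr1 in L_le; lra.
have LL0 : 0 <= LL by lra.
have X0 : 0 <= N%:R * LL by rewrite mulr_ge0.
(* The primes p <= D prime to the Dirichlet denominator cost at most 32 U, those
   p > D at most 96 U, and the remaining ones at most 96 V. *)
pose U := N%:R * LL / L; pose V := N%:R * LL * ln R `^ (3 / 2) / R `^ (1 / 2).
have U0 : 0 <= U by rewrite divr_ge0 // ltW.
have V0 : 0 <= V by rewrite divr_ge0 ?mulr_ge0 ?powR_ge0.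
rewrite -/U -/V ger0_norm ?addr_ge0 //.
have -> : 128 * C * (U + V) = C * (128 * (U + V)) by ring.
have C0 : 0 <= C := le_trans ler01 C1.
apply: ler_wpM2l => //.
pose P := N%:R / L.
have P0 : 0 <= P by rewrite divr_ge0 // ltW.
have UE : U = P * LL by rewrite /U /P mulrAC.
have near : N%:R / n%:R <= 2 * P.
  by rewrite /P mulrCA ler_pM2l.
have small : 4 * i.+1%:R * (3 * 2 ^ i + 1)%:R <= 16 * (N%:R / n%:R) :> K.
  rewrite mulrA ler_pdivlMr // -!natrM ler_nat.
  have nn_le : (n * n * 2 ^ i <= N)%N.
    have /andP[+ _] := nN; apply: leq_trans.
    rewrite [X in (_ <= 2 ^ X)%N]nE (expnD 2 (m.+2 + m.+2) i) (expnD 2 m.+2 m.+2).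
    by rewrite leq_mul2r leq_mul ?orbT // ltnW.
  have le_3D1 : (3 * 2 ^ i + 1 <= 4 * 2 ^ i)%N.
    by rewrite (mulSnr 3) leq_add2l expn_gt0.
  apply: (@leq_trans (4 * n * (4 * 2 ^ i) * n)).
    by rewrite leq_mul2r leq_mul ?orbT // leq_mul2l i_lt.
  have -> : (4 * n * (4 * 2 ^ i) * n = 16 * (n * n * 2 ^ i))%N by ring.
  by rewrite leq_mul2l nn_le.
have large : N%:R * (2 * (n.+1 - i)%:R / i%:R) <= 12 * m.+2%:R * (N%:R / n%:R) :> K.
  have i0 : 0 < i%:R :> K by rewrite ltr0n; case/andP: i_itv.
  rewrite [leRHS]mulrCA ler_pM2l // ler_pdivrMr // mulrAC ler_pdivlMr //.
  rewrite -!natrM ler_nat.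
  rewrite diE; apply: (@leq_trans (2 * (2 * m.+2 + 1) * (2 * i))).
    by rewrite leq_mul2l n_le2i orbT.
  have -> : (2 * (2 * m.+2 + 1) * (2 * i) = (8 * m.+2 + 4) * i)%N by ring.
  by rewrite leq_mul2r m_lin orbT.
have main : 2 * N%:R / R * (2 + 2 * m.+2%:R) <= 96 * V.
  have := ler_wpM2l X0 (inv_le_ln_powR_div R2).
  have -> : N%:R * LL * (4 * (ln R `^ (3 / 2) / R `^ (1 / 2))) = 4 * V.
    by rewrite /V; ring.
  move=> le_V; apply: (@le_trans _ _ (2 * N%:R / R * (12 * LL))).
    by rewrite ler_wpM2l ?divr_ge0 ?mulr_ge0 // ?ltW //; lra.
  have -> : 2 * N%:R / R * (12 * LL) = 24 * (N%:R * LL / R) by ring.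
  by lra.
have mP : m.+2%:R * P <= 4 * U.
  have -> : 4 * U = 4 * LL * P by rewrite UE; ring.
  exact: ler_wpM2r.
have PU : P <= U by rewrite UE; apply: ler_peMr.
have mnear : m.+2%:R * (N%:R / n%:R) <= m.+2%:R * (2 * P).
  exact: ler_wpM2l.
lra.
Qed.
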